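(* Let $m\ge 2$ be an integer. Then every $m$-generated member of $\mathbf{SUB}_2$ belongs to $\mathbf{SUB}_{2,2^m-1}$. In particular, the variety $\mathbf{SUB}_2$ is locally finite.
   Context: For a poset $(P,\trianglelefteq)$, a subset $X\subseteq P$ is order-convex if $x\trianglelefteq z\trianglelefteq y$ and $\{x,y\}\subseteq X$ imply $z\in X$. $\mathbf{Co}(P)$ is the lattice of all order-convex subsets of $P$ under inclusion. The length of $P$ is the supremum of $|C|-1$ over finite subchains $C$ of $P$. $\mathbf{SUB}_2$ is the class of all lattices that can be embedded into $\mathbf{Co}(P)$ for some poset $P$ of length at most $2$ (it is a variety). For nonempty disjoint sets $I$ and $J$, $P_{I,J}$ is the poset $I\cup J\cup\{p\}$, where $p\notin I\cup J$, with nontrivial coverings $x\vartriangleleft p$ for $x\in I$ and $p\vartriangleleft y$ for $y\in J$. For a positive integer $k$, $\mathbf{SUB}_{2,k}$ is the class of all lattices that can be embedded into a product of lattices of the form $\mathbf{Co}(P_{I,J})$ with $|I|+|J|\le k$. A variety is locally finite if each of its finitely generated members is finite. *)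

(* Defs.v *)
From HB Require Import structures.
From mathcomp Require Import all_boot all_order finmap.
From mathcomp Require Import boolp classical_sets cardinality.

Set Implicit Arguments.
Unset Strict Implicit.
Unset Printing Implicit Defensive.

Import Order.TTheory.
Local Open Scope classical_set_scope.

Section OrderConvex.
Context {d : Order.disp_t} {P : porderType d}.
Implicit Types X Y : set P.

Definition order_convex X : Prop :=
  forall x y z : P, X x -> X y -> (x <= z)%O -> (z <= y)%O -> X z.

Definition convex_hull X : set P :=
  [set z | exists x y : P, [/\ X x, X y, (x <= z)%O & (z <= y)%O]].

Lemma order_convexI X Y :
  order_convex X -> order_convex Y -> order_convex (X `&` Y).
Proof.
move=> cX cY x y z [Xx Yx] [Xy Yy] xz zy.
by split; [exact: cX Xx Xy xz zy | exact: cY Yx Yy xz zy].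
Qed.

Lemma order_convex_hull X : order_convex (convex_hull X).
Proof.
move=> x y z [a [_ [Xa _ ax _]]] [_ [b [_ Xb _ yb]]] xz zy.
by exists a, b; split => //; [exact: le_trans xz | exact: le_trans yb].
Qed.

Lemma sub_convex_hull X : X `<=` convex_hull X.
Proof. by move=> x Xx; exists x, x. Qed.

Lemma convex_hull_sub X Y :
  order_convex Y -> X `<=` Y -> convex_hull X `<=` Y.
Proof. by move=> cY XY z [x [y [/XY Yx /XY Yy xz zy]]]; exact: cY Yx Yy xz zy. Qed.

End OrderConvex.

Record Co d (P : porderType d) :=
  MkCo { Co_set : set P; Co_setP : `[< order_convex Co_set >] }.

HB.instance Definition _ d (P : porderType d) := [isSub of Co P for @Co_set d P].
HB.instance Definition _ d (P : porderType d) := [Choice of Co P by <:].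

Fact co_display : Order.disp_t. Proof. exact: Order.Disp tt tt. Qed.

HB.instance Definition _ d (P : porderType d) :=
  [SubChoice_isSubPOrder of Co P by <: with co_display].

Section CoLattice.
Context {d : Order.disp_t} {P : porderType d}.
Implicit Types X Y Z : Co P.

Lemma CoP X : order_convex (val X).
Proof. exact/asboolP/(valP X). Qed.

Definition Co_mk (X : set P) (cX : order_convex X) : Co P :=
  MkCo (asboolT cX).

Definition Co_meet X Y : Co P := Co_mk (order_convexI (@CoP X) (@CoP Y)).

Definition Co_join X Y : Co P :=
  Co_mk (@order_convex_hull _ _ (val X `|` val Y)).

Lemma Co_leP X Y : reflect (val X `<=` val Y) (X <= Y)%O.
Proof. by rewrite -Order.le_val; exact: subsetPset. Qed.

Fact Co_meetP Z X Y : (Z <= Co_meet X Y)%O = (Z <= X)%O && (Z <= Y)%O.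
Proof.
apply/Co_leP/andP => /= [ZXY|[/Co_leP ZX /Co_leP ZY] z Zz].
  by split; apply/Co_leP => z /ZXY[].
by split; [exact: ZX | exact: ZY].
Qed.

Fact Co_joinP X Y Z : (Co_join X Y <= Z)%O = (X <= Z)%O && (Y <= Z)%O.
Proof.
apply/Co_leP/andP => /= [XYZ|[/Co_leP XZ /Co_leP YZ]].
  split; apply/Co_leP => x Xx; apply: XYZ; apply: sub_convex_hull.
    by left.
  by right.
apply: convex_hull_sub; first exact: CoP.
by move=> x [/XZ|/YZ].
Qed.

HB.instance Definition _ :=
  Order.POrder_isMeetSemilattice.Build co_display (Co P) Co_meetP.
HB.instance Definition _ :=
  Order.POrder_isJoinSemilattice.Build co_display (Co P) Co_joinP.

Lemma Co_meetE X Y : val (X `&` Y)%O = val X `&` val Y.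
Proof. by []. Qed.

Lemma Co_joinE X Y : val (X `|` Y)%O = convex_hull (val X `|` val Y).
Proof. by []. Qed.

End CoLattice.

Definition lprod (K : Type) d (L : K -> latticeType d) : Type := forall k, L k.

Fact lprod_display : Order.disp_t. Proof. exact: Order.Disp tt tt. Qed.

Section ProductLattice.
Context {K : Type} {d : Order.disp_t} {L : K -> latticeType d}.
Implicit Types f g h : lprod L.

HB.instance Definition _ := Choice.copy (lprod L) (forall k, L k).

Definition lprod_le f g : bool := `[< forall k, (f k <= g k)%O >].
Definition lprod_meet f g : lprod L := fun k => (f k `&` g k)%O.
Definition lprod_join f g : lprod L := fun k => (f k `|` g k)%O.

Fact lprod_le_refl : reflexive lprod_le.
Proof. by move=> f; apply/asboolP => k. Qed.

Fact lprod_le_anti : antisymmetric lprod_le.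
Proof.
move=> f g /andP[/asboolP fg /asboolP gf]; apply: functional_extensionality_dep.
by move=> k; apply/eqP; rewrite eq_le fg gf.
Qed.

Fact lprod_le_trans : transitive lprod_le.
Proof.
move=> g f h /asboolP fg /asboolP gh; apply/asboolP => k.
exact: le_trans (fg k) (gh k).
Qed.

HB.instance Definition _ := Order.Le_isPOrder.Build lprod_display (lprod L)
  lprod_le_refl lprod_le_anti lprod_le_trans.

Lemma lprod_leP f g : reflect (forall k, (f k <= g k)%O) (f <= g)%O.
Proof. exact: asboolP. Qed.

Fact lprod_meetP h f g : (h <= lprod_meet f g)%O = (h <= f)%O && (h <= g)%O.
Proof.
apply/lprod_leP/andP => [hfg|[/lprod_leP hf /lprod_leP hg] k].
  by split; apply/lprod_leP => k; have := hfg k; rewrite lexI => /andP[].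
by rewrite lexI hf hg.
Qed.

Fact lprod_joinP f g h : (lprod_join f g <= h)%O = (f <= h)%O && (g <= h)%O.
Proof.
apply/lprod_leP/andP => [fgh|[/lprod_leP fh /lprod_leP gh] k].
  by split; apply/lprod_leP => k; have := fgh k; rewrite leUx => /andP[].
by rewrite leUx fh gh.
Qed.

HB.instance Definition _ :=
  Order.POrder_isMeetSemilattice.Build lprod_display (lprod L) lprod_meetP.
HB.instance Definition _ :=
  Order.POrder_isJoinSemilattice.Build lprod_display (lprod L) lprod_joinP.

End ProductLattice.

(* The poset P_{I,J} on the disjoint union of I, J and {p}: [None] stands for
   p, [Some (inl i)] for i in I and [Some (inr j)] for j in J.                *)

Definition PIJ (I J : choiceType) : Type := option (I + J).

Fact PIJ_display : Order.disp_t. Proof. exact: Order.Disp tt tt. Qed.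

Section PIJ.
Context {I J : choiceType}.

HB.instance Definition _ := Choice.on (PIJ I J).

Definition PIJ_le (x y : PIJ I J) : bool :=
  match x, y with
  | Some (inl i), Some (inl i') => i == i'
  | Some (inl _), _ => true
  | None, Some (inl _) => false
  | None, _ => true
  | Some (inr j), Some (inr j') => j == j'
  | Some (inr _), _ => false
  end.

Fact PIJ_le_refl : reflexive PIJ_le.
Proof. by case=> [[i|j]|] /=. Qed.

Fact PIJ_le_anti : antisymmetric PIJ_le.
Proof.
by case=> [[i|j]|] [[i'|j']|] //=; [case/andP => /eqP -> | case/andP => /eqP ->].
Qed.

Fact PIJ_le_trans : transitive PIJ_le.
Proof.
by case=> [[i|j]|] [[i'|j']|] [[i''|j'']|] //= /eqP -> // /eqP ->.
Qed.

HB.instance Definition _ := Order.Le_isPOrder.Build PIJ_display (PIJ I J)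
  PIJ_le_refl PIJ_le_anti PIJ_le_trans.

End PIJ.

Definition poset_length_le d (P : porderType d) (n : nat) : Prop :=
  forall C : {fset P},
    {in C &, forall x y, (x >=< y)%O} -> ((#|` C|).-1 <= n)%N.

Definition embeds d d' (L : latticeType d) (L' : latticeType d') : Prop :=
  exists f : {lmorphism L -> L'}, injective f.

Definition SUB2 d (L : latticeType d) : Prop :=
  exists (d' : Order.disp_t) (P : porderType d'),
    poset_length_le P 2 /\ embeds L (Co P).

(* The bound |I| + |J| <= k forces I and J to be finite. *)
Definition SUB2k (k : nat) d (L : latticeType d) : Prop :=
  exists (K : Type) (I J : K -> finType),
    (forall a, [/\ (0 < #|I a|)%N, (0 < #|J a|)%N & (#|I a| + #|J a| <= k)%N])
    /\ embeds L (lprod (fun a => Co (PIJ (I a) (J a)))).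

Definition sublattice d (L : latticeType d) (S : set L) : Prop :=
  Order.ClosedPredicates.meet_closed [in S] /\
  Order.ClosedPredicates.join_closed [in S].

(* [g] may repeat elements, so this says: generated by at most [m] elements
   (and by at least one when [m > 0]).                                        *)
Definition generated_by (m : nat) d (L : latticeType d) : Prop :=
  exists g : 'I_m -> L, smallest (@sublattice d L) (range g) = [set: L].

Definition finitely_generated d (L : latticeType d) : Prop :=
  exists m, generated_by m L.

Definition locally_finite
    (V : forall d : Order.disp_t, latticeType d -> Prop) : Prop :=
  forall (d : Order.disp_t) (L : latticeType d),
    V d L -> finitely_generated L -> finite_set [set: L].

(* Main.v *)
From HB Require Import structures.
Require Import Defs.
From mathcomp Require Import all_boot all_order finmap.
From mathcomp Require Import boolp classical_sets cardinality.

(** Let [L] be a sublattice of [Co P], with [P] of length at most 2, generated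
    by [A_1, ..., A_m].  A convex hull can add a point [z] only as the middle of
    a chain [x < z < y]; the length bound then makes [x] minimal and [y]
    maximal, so that neither can itself be added by a hull ([extremal]).  The
    only thing that joins need to know about [P] is thus, for each [z], its
    star: [z] with the extremal points below and above it.

    Call the set of indices [i] with [x] in [A_i] the type of [x].  By induction
    on lattice terms, an element of [L] that contains an extremal point [x] also
    contains every point whose type includes that of [x] ([occurs_sub]).  In
    particular extremal points of the same type are indistinguishable by [L],
    and the star of [z] can be collapsed to types.  Moreover the extremal
    neighbours of [z] whose type lies inside the type of [z] may be dropped: if
    such a point belongs to [X], so does [z] already, hence it never contributes
    to adding [z] to a join.  A type [T] that survives both below and above [z]
    would be that of some [x < z] and of some [y > z]; convexity of the [A_i]
    would then put [z] in [A_i] for all [i] in [T], so that [T] would have been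
    dropped.  The surviving types of the two arms are therefore disjoint sets of
    nonempty subsets of the [m] indices, and there are at most [2 ^ m - 1] of
    them ([card_arms]).  The maps from [L] to the lattices of these small stars,
    one for each [z], are homomorphisms ([starI], [starU]) that jointly
    determine membership of every point, which is the required embedding.

    For local finiteness, the same induction shows that membership of [z] in the
    elements of [L] depends only on the type of [z] and on the sets of types of
    extremal points below and above it ([occurs_profile]).  There are finitely
    many such profiles, and an element of [L] is determined by the profiles of
    its points. *)

Set Implicit Arguments.
Unset Strict Implicit.
Unset Printing Implicit Defensive.

Import Order.TTheory.

Lemma embeds_intro d d' (L : latticeType d) (L' : latticeType d') (f : L -> L') :
  {morph f : x y / (x `&` y)%O} -> {morph f : x y / (x `|` y)%O} ->
  injective f -> embeds L L'.
Proof.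
move=> fI fU finj.
have fle : {homo f : x y / (x <= y)%O}.
  by move=> x y /meet_idPl xy; rewrite -xy fI leIr.
pose F : {lmorphism L -> L'} := HB.pack f
  (Order.isOrderMorphism.Build _ _ _ _ f fle)
  (Order.isMeetLatticeMorphism.Build _ _ _ _ f fI)
  (Order.isJoinLatticeMorphism.Build _ _ _ _ f fU).
by exists F.
Qed.

(** * Extremal points and joins in posets of length at most 2 *)

Section Extremal.
Context {d : Order.disp_t} {P : porderType d}.
Implicit Types (x y z : P) (A B : Co P).

(** In a poset of length at most 2 this holds for the points that are not the
    middle of a three-element chain.  The lattice-theoretic form is the one that
    inductions on lattice terms use. *)
Definition extremal x : Prop :=
  forall A B, val (A `|` B)%O x -> val A x \/ val B x.

Lemma four_chain_length (a b c e : P) :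
  (a < b)%O -> (b < c)%O -> (c < e)%O -> ~ poset_length_le P 2.
Proof.
move=> ab bc ce P2.
have ac := lt_trans ab bc; have be := lt_trans bc ce.
have ae := lt_trans ab be.
pose s := [:: a; b; c; e].
have us : uniq s.
  by rewrite /= !inE (lt_eqF ab) (lt_eqF ac) (lt_eqF ae) (lt_eqF bc)
    (lt_eqF be) (lt_eqF ce).
have := P2 [fset x in s]%fset; rewrite card_fseq undup_id //=.
suff: {in [fset x in s]%fset &, forall x y, (x >=< y)%O} by move=> h /(_ h).
move=> x y; rewrite !inE !orbF => /or4P[] /eqP-> /or4P[] /eqP->;
  by rewrite /Order.comparable ?lexx ?(ltW ab) ?(ltW ac) ?(ltW ae) ?(ltW bc)
    ?(ltW be) ?(ltW ce) ?orbT.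
Qed.

(** If a convex hull added the bottom or the top of a three-element chain, that
    chain would extend to one of four elements. *)
Lemma extremal_chain x z y :
  poset_length_le P 2 -> (x < z)%O -> (z < y)%O -> extremal x /\ extremal y.
Proof.
move=> P2 xz zy; split=> A B; rewrite Co_joinE => -[a [b [ABa ABb]]].
  rewrite le_eqVlt => /orP[/eqP<- // | ax _].
  by case: (four_chain_length ax xz zy P2).
rewrite [in X in _ -> X -> _]le_eqVlt => _ /orP[/eqP-> // | yb].
by case: (four_chain_length xz zy yb P2).
Qed.

Lemma mem_joinP A B z : poset_length_le P 2 ->
  val (A `|` B)%O z <->
  (val A z \/ val B z) \/
  exists x y, [/\ (x < z)%O, (z < y)%O, extremal x /\ extremal y,
                  val A x \/ val B x & val A y \/ val B y].
Proof.
move=> P2; rewrite Co_joinE; split=> [[x [y [ABx ABy]]] | [ABz | ]].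
- rewrite le_eqVlt => /orP[/eqP<- // | xz]; first by left.
  rewrite le_eqVlt => /orP[/eqP-> // | zy]; first by left.
  by right; exists x, y; split=> //; exact: extremal_chain xz zy.
- exact: sub_convex_hull.
- by move=> [x [y [/ltW xz /ltW zy _ ABx ABy]]]; exists x, y.
Qed.

End Extremal.

(** * Types of points relative to a generating family *)

Section Generated.
Context {d : Order.disp_t} {L : latticeType d}.
Context {d' : Order.disp_t} {P : porderType d'}.
Context {m : nat} (f : {lmorphism L -> Co P}) (g : 'I_m -> L).
Implicit Types (X Y : L) (x y z w : P) (A B : P -> Prop) (T : {set 'I_m}).

Definition occurs z X : Prop := val (f X) z.

Definition type_of z : {set 'I_m} := finset (fun i => `[< occurs z (g i) >]).

Definition types_in A : {set {set 'I_m}} :=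
  finset (fun T => `[< exists x, [/\ A x, extremal x & type_of x = T] >]).

Definition below z : P -> Prop := fun x => (x < z)%O.
Definition above z : P -> Prop := fun y => (z < y)%O.

(** Extremal points of type included in [type_of z] are left out: by
    [occurs_sub], an element of the lattice that contains one of them contains
    [z] as well. *)
Definition useful z A : {set {set 'I_m}} :=
  (types_in A :\: powerset (type_of z))%SET.

Lemma in_type_of z i : reflect (occurs z (g i)) (i \in type_of z).
Proof. by rewrite inE; exact: asboolP. Qed.

Lemma in_types_in A T :
  reflect (exists x, [/\ A x, extremal x & type_of x = T]) (T \in types_in A).
Proof. by rewrite inE; exact: asboolP. Qed.

Lemma occursI z X Y : occurs z (X `&` Y)%O <-> occurs z X /\ occurs z Y.
Proof. by rewrite /occurs omorphI Co_meetE. Qed.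

Lemma occursUl z X Y : occurs z X -> occurs z (X `|` Y)%O.
Proof.
by move=> zX; rewrite /occurs omorphU Co_joinE; apply: sub_convex_hull; left.
Qed.

Lemma occursUr z X Y : occurs z Y -> occurs z (X `|` Y)%O.
Proof. by rewrite joinC; exact: occursUl. Qed.

Lemma extremal_occursU x X Y :
  extremal x -> occurs x (X `|` Y)%O -> occurs x X \/ occurs x Y.
Proof. by move=> ex; rewrite /occurs omorphU; exact: ex. Qed.

Lemma occurs_between x z y X : (x < z)%O -> (z < y)%O ->
  occurs x X -> occurs y X -> occurs z X.
Proof. by move=> /ltW xz /ltW zy xX yX; exact: (CoP xX yX xz zy). Qed.

Hypothesis gen_L : smallest (@sublattice d L) (range g) = setT.

Lemma generated_ind (Q : L -> Prop) :
  (forall i, Q (g i)) ->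
  (forall X Y, Q X -> Q Y -> Q (X `&` Y)%O) ->
  (forall X Y, Q X -> Q Y -> Q (X `|` Y)%O) ->
  forall X, Q X.
Proof.
move=> Qg QI QU X.
have: smallest (@sublattice d L) (range g) X by rewrite gen_L.
apply: (@smallest_sub _ (@sublattice d L) (range g) Q).
  by split=> Y Z; rewrite !in_setE; [exact: QI | exact: QU].
by move=> _ [i _ <-].
Qed.

(** Induction on lattice terms: in the join step, [x] lies in one of the two
    terms because it is extremal, and then [w] lies in that term, hence in the
    join. *)
Lemma occurs_sub x w X : extremal x -> type_of x \subset type_of w ->
  occurs x X -> occurs w X.
Proof.
move=> ex /fintype.subsetP xw; elim/generated_ind: X => [i | X Y IX IY | X Y IX IY].
- by move=> /in_type_of/xw/in_type_of.
- by move=> /occursI[/IX ? /IY ?]; exact/occursI.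
- by case/(extremal_occursU ex)=> [/IX/occursUl | /IY/occursUr].
Qed.

Hypothesis P2 : poset_length_le P 2.

Lemma occursUP z X Y : occurs z (X `|` Y)%O <->
  (occurs z X \/ occurs z Y) \/
  exists x y, [/\ (x < z)%O, (z < y)%O, extremal x /\ extremal y,
                  occurs x X \/ occurs x Y & occurs y X \/ occurs y Y].
Proof. by rewrite /occurs omorphU; exact: mem_joinP. Qed.

(** * Finiteness *)

Definition profile z := (type_of z, types_in (below z), types_in (above z)).

(** If a join adds [z] through [x < z < y], then [w] has extremal neighbours
    [x' < w < y'] of the same types as [x] and [y], which by [occurs_sub] lie in
    whichever of the two terms [x] and [y] lie in. *)
Lemma occurs_profile z w X : profile z = profile w -> occurs z X -> occurs w X.
Proof.
case=> tzw lzw uzw; elim/generated_ind: X => [i | X Y IX IY | X Y IX IY].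
- by move=> /in_type_of; rewrite tzw => /in_type_of.
- by move=> /occursI[/IX ? /IY ?]; exact/occursI.
case/occursUP=> [[/IX/occursUl | /IY/occursUr] // | ].
case=> [x [y [xz zy [ex ey] xXY yXY]]].
have /in_types_in[x' [x'w ex' tx]] : type_of x \in types_in (below w).
  by rewrite -lzw; apply/in_types_in; exists x.
have /in_types_in[y' [wy' ey' ty]] : type_of y \in types_in (above w).
  by rewrite -uzw; apply/in_types_in; exists y.
apply/occursUP; right; exists x', y'; split=> //.
  by case: xXY => h; [left | right]; apply: occurs_sub h; rewrite ?tx.
by case: yXY => h; [left | right]; apply: occurs_sub h; rewrite ?ty.
Qed.

Hypothesis f_inj : injective f.

Lemma occurs_inj X Y : (forall z, occurs z X <-> occurs z Y) -> X = Y.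
Proof.
by move=> XY; apply: f_inj; apply: val_inj; apply: eq_set => z; exact/propext/XY.
Qed.

(** Each element is encoded by the finite set of profiles of its points; this
    loses nothing since membership of a point depends on its profile only. *)
Lemma generated_finite : finite_set (@setT L).
Proof.
pose h X := finset (fun k => `[< exists2 z, profile z = k & occurs z X >]).
have h_occurs z X : occurs z X <-> profile z \in h X.
  rewrite inE; split=> [zX | /asboolP[w wz]]; first by apply/asboolP; exists z.
  exact: occurs_profile.
rewrite -(preimage_setT h); apply: finite_preimage; last exact: finite_finset.
by move=> X Y _ _ hXY; apply: occurs_inj => z; rewrite !h_occurs hXY.
Qed.

(** * Collapsed stars *)

Definition trace A X T : Prop :=
  exists x, [/\ A x, extremal x, type_of x = T & occurs x X].

(** The points of type [T] witnessing that both traces contain [T] may differ;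
    [occurs_sub] identifies them. *)
Lemma traceI A X Y T : trace A (X `&` Y)%O T <-> trace A X T /\ trace A Y T.
Proof.
split=> [[x [Ax ex tx /occursI[xX xY]]] | [[x [Ax ex tx xX]] [y [_ ey ty yY]]]].
  by split; exists x.
exists x; split=> //; apply/occursI; split=> //.
by apply: occurs_sub yY; rewrite ?tx ?ty.
Qed.

Lemma traceU A X Y T : trace A (X `|` Y)%O T <-> trace A X T \/ trace A Y T.
Proof.
split=> [[x [Ax ex tx]] | [] [x [Ax ex tx xX]]].
- by case/(extremal_occursU ex) => ?; [left | right]; exists x.
- by exists x; split=> //; exact: occursUl.
- by exists x; split=> //; exact: occursUr.
Qed.

(** When [z] has useful types on one side at most, no join adds [z] and both
    arms can be arbitrary, as long as they are nonempty and small.  Taking the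
    empty type for each keeps the definition of [star_set] uniform. *)
Definition arm z A B : {set {set 'I_m}} :=
  if (useful z A != finset.set0) && (useful z B != finset.set0) then useful z A
  else finset.set1 finset.set0.

Definition low_arm z : finType := {T | T \in arm z (below z) (above z)}.
Definition high_arm z : finType := {T | T \in arm z (above z) (below z)}.

Lemma arm_n0 z A B : arm z A B != finset.set0.
Proof.
rewrite /arm; case: andP => [[] //|_].
by apply/set0Pn; exists finset.set0; rewrite finset.in_set1.
Qed.

(** If [x < z < y] have [type_of x = type_of y = T], then convexity of the
    generators gives [T \subset type_of z]. *)
Lemma useful_disjoint z :
  (useful z (below z) :&: useful z (above z))%SET = finset.set0.
Proof.
apply/finset.setP => T; rewrite !inE; apply/negP.
case/andP=> /andP[/negP Tz /asboolP[x [xz _ tx]]] /andP[_ /asboolP[y [zy _ ty]]].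
apply: Tz; apply/fintype.subsetP => i iT; apply/in_type_of.
by apply: (occurs_between xz zy); apply/in_type_of; rewrite ?tx ?ty.
Qed.

(** The degenerate arms account for two types, within the bound since
    [2 <= 2 ^ m - 1] for [2 <= m]. *)
Lemma card_arms z : (2 <= m)%N ->
  (#|arm z (below z) (above z)| + #|arm z (above z) (below z)| <= 2 ^ m - 1)%N.
Proof.
move=> m2; rewrite /arm [in X in (_ + X)%N]andbC.
case: ifP => _; last first.
  rewrite cards1 leq_subRL ?expn_gt0 //.
  by apply: (@leq_trans (2 ^ 2)); rewrite ?leq_exp2l.
rewrite -cardsUI useful_disjoint cards0 addn0.
suff /subset_leq_card: useful z (below z) :|: useful z (above z)
    \subset (~: [set finset.set0])%SET.
  by rewrite cardsC1 -cardsT -powersetT card_powerset cardsT card_ord subn1.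
by apply/fintype.subsetP => T; rewrite !inE; case: eqP => // ->; rewrite finset.sub0set.
Qed.

Definition star_set z X : set (PIJ (low_arm z) (high_arm z)) :=
  fun v => match v with
  | None => occurs z X
  | Some (inl T) => trace (below z) X (val T)
  | Some (inr T) => trace (above z) X (val T)
  end.

Arguments star_set : clear implicits.

Lemma star_set_convex z X : order_convex (star_set z X).
Proof.
move=> [[a|a]|] [[b|b]|] [[c|c]|] //= sa sb; rewrite /Order.le //=;
  try by move=> /eqP<-.
- by move=> _ /eqP->.
- by move: sa sb => [x [xz _ _ xX]] [y [zy _ _ yX]] _ _; exact: occurs_between xX yX.
- by move=> _ /eqP->.
Qed.

Definition star z X : Co (PIJ (low_arm z) (high_arm z)) :=
  Co_mk (@star_set_convex z X).

Lemma starI z : {morph star z : X Y / (X `&` Y)%O}.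
Proof.
move=> X Y; apply: val_inj; rewrite Co_meetE; apply: eq_set => -[[T|T]|] /=.
- exact/propext/traceI.
- exact/propext/traceI.
- exact/propext/occursI.
Qed.

Lemma star_set_sub z X Y v :
  star_set z X v \/ star_set z Y v -> star_set z (X `|` Y)%O v.
Proof.
case: v => [[T|T]|] /=; try exact: (iffRL (traceU _ _ _ _)).
by case; [exact: occursUl | exact: occursUr].
Qed.

(** The centre is the only delicate point.  If a join adds [z] through
    [x < z < y], either one of [x], [y] has its type inside that of [z], and
    then [z] was already in one of the two terms, or both types are useful, so
    that they are points of the two arms and their hull contains the centre. *)
Lemma starU z : {morph star z : X Y / (X `|` Y)%O}.
Proof.
move=> X Y; apply: val_inj; rewrite Co_joinE; apply: eq_set => v; apply/propext.
split=> [sv | ]; last first.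
  case=> a [b [XYa XYb av vb]].
  exact: star_set_convex (star_set_sub XYa) (star_set_sub XYb) av vb.
case: v sv => [[T|T]|].
- by case/traceU=> ?; apply: sub_convex_hull; [left | right].
- by case/traceU=> ?; apply: sub_convex_hull; [left | right].
case/occursUP=> [XYz | [x [y [xz zy [ex ey] xXY yXY]]]].
  exact: sub_convex_hull.
case: (boolP (type_of x \subset type_of z)) => [xsz | xnz].
  by apply: sub_convex_hull; case: xXY => h; [left | right]; apply: occurs_sub h.
case: (boolP (type_of y \subset type_of z)) => [ysz | ynz].
  by apply: sub_convex_hull; case: yXY => h; [left | right]; apply: occurs_sub h.
have xu : type_of x \in useful z (below z).
  by rewrite finset.in_setD powersetE xnz; apply/in_types_in; exists x.
have yu : type_of y \in useful z (above z).
  by rewrite finset.in_setD powersetE ynz; apply/in_types_in; exists y.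
have u0 : (useful z (below z) != finset.set0) && (useful z (above z) != finset.set0).
  by apply/andP; split; apply/set0Pn; eexists; eassumption.
have xa : type_of x \in arm z (below z) (above z) by rewrite /arm u0.
have ya : type_of y \in arm z (above z) (below z) by rewrite /arm andbC u0.
pose a : low_arm z := exist (fun T => is_true (T \in _)) _ xa.
pose b : high_arm z := exist (fun T => is_true (T \in _)) _ ya.
exists (Some (inl a)), (Some (inr b)); split=> //.
- by case: xXY => h; [left | right]; exists x.
- by case: yXY => h; [left | right]; exists y.
Qed.

Lemma generated_embeds : 
  embeds L (lprod (fun z => Co (PIJ (low_arm z) (high_arm z)))).
Proof.
pose F X : lprod (fun z => Co (PIJ (low_arm z) (high_arm z))) :=
  fun z => star z X.
apply: (@embeds_intro _ _ _ _ F).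
- by move=> X Y; apply: functional_extensionality_dep => z; exact: starI.
- by move=> X Y; apply: functional_extensionality_dep => z; exact: starU.
move=> X Y XY; apply: occurs_inj => z.
have XYz : star z X = star z Y := congr1 (fun h => h z) XY.
by rewrite -[occurs z X]/(val (star z X) None) XYz.
Qed.

End Generated.

Theorem theorem4p10 :
  (forall m : nat, (2 <= m)%N ->
     forall (d : Order.disp_t) (L : latticeType d),
       SUB2 L -> generated_by m L -> SUB2k (2 ^ m - 1) L)
  /\ locally_finite (@SUB2).
Proof.
split=> [m m2 d L [d' [P [P2 [f f_inj]]]] [g gen_L]
        | d L [d' [P [P2 [f f_inj]]]] [m [g gen_L]]]; last first.
  exact: generated_finite gen_L P2 f_inj.
exists P, (low_arm f g), (high_arm f g); split; last exact: generated_embeds.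
move=> z; rewrite !card_sig; split.
- by rewrite card_gt0 arm_n0.
- by rewrite card_gt0 arm_n0.
- exact: card_arms.
Qed.
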